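(* Let $T>0$, $h>0$, $\gamma>1/2$, $x\in\mathcal C_1^{\gamma}([0,T];\mathbb R^d)$, $\xi\in\mathcal C_1^{\gamma}([-h,0];\mathbb R^n)$ and $\lambda\in(1/2,\gamma)$. Let $f:\mathcal C_1^{\lambda}([-h,0];\mathbb R^n)\to\mathbb R^{n\times d}$ satisfy the following two conditions. (i) There is a constant $M>0$ such that $|f(\zeta)|\le M$ and $|f(\zeta_2)-f(\zeta_1)|\le M\sup_{\theta\in[-h,0]}|\zeta_2(\theta)-\zeta_1(\theta)|$ for all $\zeta,\zeta_1,\zeta_2\in\mathcal C_1^{\lambda}([-h,0];\mathbb R^n)$. (ii) For every $N\ge1$ there is a constant $c_N>0$ such that $$\|\mathcal U^{(a)}(Z_1)-\mathcal U^{(a)}(Z_2)\|_{\lambda,[a_1,a_2]}\le c_N\|Z_1-Z_2\|_{\lambda,[a_1-h,a_2]}$$ for all $0\le a_1\le a_2\le T$, all $\rho\in\mathcal C_1^\lambda([a_1-h,a_1];\mathbb R^n)$ and all $Z_1,Z_2\in\mathcal C^{\lambda}_{\rho,a_1,a_2}(\mathbb R^n)$ with $\max\{\|Z_1\|_{\lambda,[a_1-h,a_2]},\|Z_2\|_{\lambda,[a_1-h,a_2]}\}\le N$. Then the delay equation $$y_t=\xi_0+\int_0^t f(\mathcal Z^y_u)\,dx_u,\quad t\in[0,T],\qquad \mathcal Z^y_0=\xi,$$ has a unique solution in $\mathcal C^{\lambda}_{\xi,0,T}(\mathbb R^n)$.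
   Context: $\mathcal C_1^\mu([a,b];V)$ is the space of continuous $g:[a,b]\to V$ with $\|g\|_{\mu,[a,b]}=\sup_{s\ne t\in[a,b]}|g_t-g_s|/|t-s|^\mu<\infty$. For $\rho\in\mathcal C_1^\mu([a_1-h,a_1];V)$, $\mathcal C^\mu_{\rho,a_1,a_2}(V)=\{\zeta\in\mathcal C_1^\mu([a_1-h,a_2];V):\zeta=\rho\text{ on }[a_1-h,a_1]\}$. For a function $y$ defined on an interval containing $[t-h,t]$, $\mathcal Z^y_t:[-h,0]\to\mathbb R^n$ is $\mathcal Z^y_t(s)=y_{t+s}$. For $a=(a_1,a_2)$ and $Z\in\mathcal C_1^\lambda([a_1-h,a_2];\mathbb R^n)$, $[\mathcal U^{(a)}Z]_s=f(\mathcal Z^Z_s)$ for $s\in[a_1,a_2]$. Integrals with respect to $x$ are Young integrals: $\int_s^t g_u\,dx_u=\lim\sum_i g_{t_i}(x_{t_{i+1}}-x_{t_i})$ over partitions of $[s,t]$ with mesh tending to $0$, which exists if the Hölder exponents of $g$ and $x$ sum to more than $1$. *)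

(* Defs.v *)
From HB Require Import structures.
From mathcomp Require Import all_boot all_order all_algebra.
From mathcomp Require Import all_classical all_reals all_analysis.

Set Implicit Arguments.
Unset Strict Implicit.
Unset Printing Implicit Defensive.

Import Order.TTheory GRing.Theory Num.Theory.
Import numFieldNormedType.Exports.

Local Open Scope classical_set_scope.
Local Open Scope ring_scope.

(* A function on an interval is represented by a total function R -> V whose
   values outside the interval are never used.  R^n is 'cV[R]_n and R^{n x d}
   is 'M[R]_(n, d), with the library (maximum) norm. *)

Section Hoelder.
Variables (R : realType) (V : normedModType R).
Implicit Types (g : R -> V) (a b mu : R).

(* [maxe 0] only matters when a = b: the supremum is then over the empty set
   and ereal_sup would give -oo instead of 0. *)
Definition hoelder_norm mu a b g : \bar R :=
  maxe 0%E (ereal_sup [set (`|g p.2 - g p.1| / `|p.2 - p.1| `^ mu)%:E |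
    p in [set p : R * R | [/\ p.1 \in `[a, b], p.2 \in `[a, b] & p.1 != p.2]]]).

Definition hoelder_space mu a b : set (R -> V) :=
  [set g | {within `[a, b], continuous g} /\ (hoelder_norm mu a b g < +oo)%E].

Definition hoelder_space_from mu h (rho : R -> V) a1 a2 : set (R -> V) :=
  [set zeta | hoelder_space mu (a1 - h) a2 zeta /\
              {in `[a1 - h, a1], zeta =1 rho}].

Definition sup_dist a b (g1 g2 : R -> V) : \bar R :=
  ereal_sup [set (`|g2 theta - g1 theta|)%:E | theta in `[a, b]].

(* The segment Z^y_t. *)
Definition segment (y : R -> V) (t : R) : R -> V := fun s => y (t + s).

End Hoelder.

Section Young.
Variables (R : realType) (n d : nat).

(* A partition a = t_0 < t_1 < ... < t_k = b is the list [:: t_1; ...; t_k],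
   as in [itv_partition]; t_i is then [nth b (a :: s) i]. *)
Definition mesh (a b : R) (s : seq R) : R :=
  \big[Num.max/0]_(i < size s) (nth b (a :: s) i.+1 - nth b (a :: s) i).

Definition mesh_to0 (a b : R) : set_system (seq R) :=
  filter_from [set delta : R | 0 < delta]
    (fun delta => [set s | itv_partition a b s /\ mesh a b s < delta]).

Definition young_sum (g : R -> 'M[R]_(n, d)) (x : R -> 'cV[R]_d)
    (a b : R) (s : seq R) : 'cV[R]_n :=
  \sum_(i < size s) g (nth b (a :: s) i) *m
                    (x (nth b (a :: s) i.+1) - x (nth b (a :: s) i)).

Definition is_young_integral (g : R -> 'M[R]_(n, d)) (x : R -> 'cV[R]_d)
    (a b : R) (I : 'cV[R]_n) : Prop :=
  young_sum g x a b s @[s --> mesh_to0 a b] --> I.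

End Young.

Section DelayEquation.
Variables (R : realType) (n d : nat).
Variable f : (R -> 'cV[R]_n) -> 'M[R]_(n, d).

(* The map U^(a) Z; it is only looked at on [a_1, a_2]. *)
Definition delay_map (Z : R -> 'cV[R]_n) : R -> 'M[R]_(n, d) :=
  fun s => f (segment Z s).

(* In particular f only depends on the restriction of its argument
   to [-h, 0], for arguments in the Hoelder space. *)
Definition bounded_lipschitz (h lambda : R) : Prop :=
  exists2 M : R, 0 < M &
    (forall zeta, hoelder_space lambda (- h) 0 zeta -> `|f zeta| <= M) /\
    (forall zeta1 zeta2,
       hoelder_space lambda (- h) 0 zeta1 ->
       hoelder_space lambda (- h) 0 zeta2 ->
       ((`|f zeta2 - f zeta1|)%:E <= M%:E * sup_dist (- h) 0 zeta1 zeta2)%E).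

Definition locally_lipschitz_delay_map (T h lambda : R) : Prop :=
  forall N : R, 1 <= N -> exists2 c : R, 0 < c &
    forall a1 a2 : R, 0 <= a1 -> a1 <= a2 -> a2 <= T ->
    forall rho, hoelder_space lambda (a1 - h) a1 rho ->
    forall Z1 Z2,
      hoelder_space_from lambda h rho a1 a2 Z1 ->
      hoelder_space_from lambda h rho a1 a2 Z2 ->
      (maxe (hoelder_norm lambda (a1 - h) a2 Z1)
            (hoelder_norm lambda (a1 - h) a2 Z2) <= N%:E)%E ->
      (hoelder_norm lambda a1 a2 (fun s => delay_map Z1 s - delay_map Z2 s)%R
         <= c%:E * hoelder_norm lambda (a1 - h) a2 (fun s => Z1 s - Z2 s)%R)%E.

Definition delay_solution (T h : R) (x : R -> 'cV[R]_d) (xi y : R -> 'cV[R]_n)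
    : Prop :=
  (forall t, t \in `[0, T] ->
     exists2 I, is_young_integral (fun u => f (segment y u)) x 0 t I &
       y t = xi 0 + I) /\
  {in `[- h, 0], segment y 0 =1 xi}.

End DelayEquation.

(* Main.v *)
(** A Young sum over any partition of [[s, t]] differs from its one-term sum
    [g s (x t - x s)] by at most a constant times [(t - s)^(lambda + gamma)].
    Summed over the cells of a partition this makes the Young sums Cauchy as
    the mesh tends to 0, and it bounds the integral on short intervals.

    Consider the Picard map sending [z] to [xi 0 + int_0^t f (segment z) dx].
    If the Hoelder bound is only required for points at distance at most [e0],
    with [e0] small in terms of the bounds on [f] and [x] alone, then a ball for
    this local seminorm is stable under the Picard map on every [[-h, b]].  It
    gives a global Hoelder bound [N], and with the Lipschitz constant of
    condition (ii) for [N] the Picard map halves the Hoelder seminorm of the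
    difference of two functions that agree up to [a], on [[-h, a + e]] with
    [e] independent of [a].  Existence and uniqueness thus propagate by steps
    of length [e]. *)

Require Import Defs.
From HB Require Import structures.
From mathcomp Require Import all_boot all_order all_algebra.
From mathcomp Require Import all_classical all_reals all_analysis.
From mathcomp Require Import ring lra.

Set Implicit Arguments.
Unset Strict Implicit.
Unset Printing Implicit Defensive.

Import Order.TTheory GRing.Theory Num.Theory.
Import numFieldNormedType.Exports.

Local Open Scope classical_set_scope.
Local Open Scope ring_scope.

(** * Powers of real numbers *)

Section PowR.
Context {R : realType}.
Implicit Types (x y p q : R).

Lemma powR_le p x y : 0 <= p -> 0 <= x -> x <= y -> x `^ p <= y `^ p.
Proof.
move=> p0 x0 xy; apply: ge0_ler_powR => //; rewrite nnegrE //.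
exact: le_trans xy.
Qed.

Lemma powR_add p q x : 0 < p -> 0 < q -> x `^ (p + q) = x `^ p * x `^ q.
Proof.
by move=> p0 q0; rewrite powRD // gt_eqF // addr_gt0.
Qed.

Lemma powR_split p q x : 0 < q -> q < p -> x `^ p = x `^ (p - q) * x `^ q.
Proof. by move=> q0 qp; rewrite -powR_add ?subrK// subr_gt0. Qed.

Lemma powR_small p (eta : R) : 0 < p -> 0 < eta ->
  exists2 delta, 0 < delta & delta `^ p <= eta.
Proof.
move=> p0 e0; exists (eta `^ p^-1); first exact: powR_gt0.
by rewrite -powRrM mulVf ?gt_eqF// powRr1// ltW.
Qed.

End PowR.

(** * Sums over partitions and the sewing estimate *)

Section PartitionSums.
Context {R : realType} {V : normedModType R}.
Implicit Types (A : R -> R -> V) (a b C theta : R) (s : seq R).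

(** Recursion on the list, instead of the indices of [young_sum], lets the sum split along
    concatenations of partitions. *)
Fixpoint part_sum A a s : V :=
  if s is t :: s' then A a t + part_sum A t s' else 0.

Lemma part_sum_cat A a s1 s2 :
  part_sum A a (s1 ++ s2) = part_sum A a s1 + part_sum A (last a s1) s2.
Proof. by elim: s1 a => [|t s1 ih] a /=; rewrite ?add0r// ih addrA. Qed.

(** The hypothesis of the sewing lemma: the defect of additivity at an intermediate point is of
    order [theta], which is larger than 1 in the estimates below. *)
Definition almost_additive A a b (C theta : R) : Prop :=
  forall s u t : R, a <= s -> s <= u -> u <= t -> t <= b ->
    `|A s t - A s u - A u t| <= C * (t - s) `^ theta.

(** The solution of K = 2 K (1/2)^theta + 2, the recursion produced by halving intervals. *)
Definition sewing_const (theta : R) : R := 2 / (1 - 2 * 2^-1 `^ theta).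

(** Two halves cost 2 (1/2)^theta = (1/2)^(theta - 1), which is below 1 exactly because [theta]
    exceeds 1. *)
Lemma sewing_const_den (theta : R) : 1 < theta -> 0 < 1 - 2 * 2^-1 `^ theta :> R.
Proof.
move=> th; rewrite (@powR_split _ _ 1) // powRr1 // mulrCA divff // mulr1 subr_gt0.
have : 2^-1 `^ (theta - 1) < 1 `^ (theta - 1) :> R; last by rewrite powR1.
by rewrite gt0_ltr_powR ?subr_gt0 ?nnegrE // invf_lt1 // ltrDl.
Qed.

Lemma sewing_const_gt0 (theta : R) : 1 < theta -> 0 < sewing_const theta.
Proof. by move=> th; rewrite divr_gt0 // sewing_const_den. Qed.

Lemma path_lt_last a s : path <%R a s -> a <= last a s.
Proof.
by elim: s a => [|t s ih] a //= /andP[/ltW at_ /ih]; apply: le_trans.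
Qed.

Lemma path_lt_last_gt a s : path <%R a s -> s != [::] -> a < last a s.
Proof. by case: s => [//|t s] /= /andP[at_ /path_lt_last ts] _; apply: lt_le_trans ts. Qed.

(** With all three points equal, the defect is [- A s s] and its bound is C 0^theta = 0. *)
Lemma almost_additive_diag A a b C theta (s : R) : 0 < theta ->
  almost_additive A a b C theta -> a <= s -> s <= b -> A s s = 0.
Proof.
move=> th /(_ s s s) H as_ sb; apply/eqP; rewrite -normr_le0.
have := H as_ (lexx _) (lexx _) sb.
by rewrite !subrr sub0r normrN powR0 ?gt_eqF// mulr0.
Qed.

(* The interval of the partition that contains the midpoint of [a, b] is cut
   off: both remaining pieces are at most half as long, so the error satisfies
   K <= 2 K (1/2)^theta + 2 C. *)
Lemma part_sum_sewing A a b C theta a0 s : 1 < theta -> 0 <= C ->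
  almost_additive A a b C theta -> a <= a0 -> path <%R a0 s -> last a0 s <= b ->
  `|part_sum A a0 s - A a0 (last a0 s)|
     <= sewing_const theta * C * (last a0 s - a0) `^ theta.
Proof.
move=> th C0 hA.
have th0 : 0 < theta by exact: lt_trans th.
have K0 := sewing_const_gt0 th.
have [m] := ubnP (size s); elim: m a0 s => // m ih a0 s sm aa0 ps sb.
have a0s := path_lt_last ps.
have [s0|snil] := eqVneq s [::].
  rewrite s0 /= (almost_additive_diag th0 hA) //; last by rewrite s0 in sb.
  by rewrite !subrr normr0 powR0 ?gt_eqF// mulr0.
have lts := path_lt_last_gt ps snil.
have [c ce] : exists c, c = (a0 + last a0 s) / 2 by eexists.
have cs : c < last a0 s by lra.
have ca : a0 < c by lra.
(* The first partition point beyond the midpoint [c] becomes [u]; the point before it, possibly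
   [a0], becomes [l], so [l <= c < u]. *)
have hs : has (fun u => c < u) s.
  by apply/hasP; exists (last a0 s) => //; case: (s) snil => //= ? ?; rewrite mem_last.
have es := split_find hs; set s1 := take _ s in es; set s2 := drop _ s in es.
case: es ce sm ps sb a0s lts ca cs => {hs snil s1 s2} [u s1 s2] cu ns1.
rewrite cat_rcons last_cat /= => ce sm ps sb a0s lts ca cs.
move: ps; rewrite cat_path /= => /andP[ps1 /andP[lu ps2]].
set l := last a0 s1 in lu *; set e := last u s2 in ce sb a0s lts ca cs *.
have lc : l <= c.
  have /orP[/eqP ->|ls1] : (l == a0) || (l \in s1).
  - by rewrite -in_cons mem_last.
  - exact: ltW.
  - by have := hasPn ns1 _ ls1; rewrite -leNgt.
have a0l := path_lt_last ps1; have ue := path_lt_last ps2.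
rewrite -/l -/e in a0l ue.
have sz1 : (size s1 < m)%N.
  by move: sm; rewrite size_cat /= addnS ltnS; apply: leq_trans; rewrite ltnS leq_addr.
have sz2 : (size s2 < m)%N.
  by move: sm; rewrite size_cat /= addnS ltnS; apply: leq_trans; rewrite ltnS leq_addl.
have lb : l <= b by apply: le_trans lc _; apply: le_trans sb; exact: ltW.
have := ih a0 s1 sz1 aa0 ps1 lb; rewrite -/l => h1.
have au : a <= u by apply: le_trans aa0 _; apply: le_trans (ltW ca) _; exact: ltW.
have := ih u s2 sz2 au ps2 sb; rewrite -/e => h2.
have half x : 0 <= x -> x <= (e - a0) / 2 -> x `^ theta <= 2^-1 `^ theta * (e - a0) `^ theta.
  move=> x0 xe; rewrite -powRM ?invr_ge0 // ?subr_ge0 // powR_le //; last by rewrite mulrC.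
  exact: ltW.
have hl : (l - a0) `^ theta <= 2^-1 `^ theta * (e - a0) `^ theta.
  by apply: half; [rewrite subr_ge0|lra].
have hu : (e - u) `^ theta <= 2^-1 `^ theta * (e - a0) `^ theta.
  by apply: half; [rewrite subr_ge0|lra].
have le_ : l <= e by lra.
have d1 := hA a0 l e aa0 a0l le_ sb.
have al : a <= l by exact: le_trans a0l.
have d2 := hA l u e al (ltW lu) ue sb.
have hle : (e - l) `^ theta <= (e - a0) `^ theta.
  by apply: powR_le; [exact: ltW|rewrite subr_ge0|rewrite lerD2l lerN2].
rewrite part_sum_cat /= -/l.
set P1 := part_sum A a0 s1 in h1 *; set P2 := part_sum A u s2 in h2 *.
(* The error consists of the errors on [[a0, l]] and [[u, e]], controlled by induction, and of two
   additivity defects, at [l] and at [u]. *)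
have -> : P1 + (A l u + P2) - A a0 e =
    (P1 - A a0 l) + (P2 - A u e) - (A a0 e - A a0 l - A l e) - (A l e - A l u - A u e).
  rewrite !opprD !opprK !addrA.
  by rewrite [RHS](ACl ((1*9*3*5)*(6*2)*(10*4)*(7*8))) /= !subrr !addr0.
rewrite (le_trans (ler_normB _ _)) //.
have t1 := ler_normB (P1 - A a0 l + (P2 - A u e)) (A a0 e - A a0 l - A l e).
have t2 := ler_normD (P1 - A a0 l) (P2 - A u e).
set E := (e - a0) `^ theta in hl hu hle d1 *.
have q0 := sewing_const_den th.
(* The equation that defines [sewing_const], multiplied by [C * E]. *)
have Keq : sewing_const theta * C * E
    = 2 * (sewing_const theta * C * (2^-1 `^ theta * E)) + 2 * (C * E).
  by rewrite /sewing_const; field; rewrite gt_eqF.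
have KC0 : 0 <= sewing_const theta * C by rewrite mulr_ge0 // ltW.
have m1 := ler_wpM2l KC0 hl; have m2 := ler_wpM2l KC0 hu; have m3 := ler_wpM2l C0 hle.
rewrite Keq; lra.
Qed.



Definition gap_lt (delta : R) : rel R := fun u v => v - u < delta.

Lemma path_sub_lt_last a s1 t s2 (r : R) :
  path <%R a (rcons s1 t ++ s2) -> r \in s1 -> r < t.
Proof.
move=> p rs; have : sorted <%R (rcons s1 t ++ s2) by exact: path_sorted p.
rewrite sorted_pairwise; last exact: lt_trans.
rewrite pairwise_cat => /and3P[_]; rewrite pairwise_rcons => /andP[/allP h _] _.
exact: h.
Qed.

(** The sewing estimate applies on each cell of [s], which [q] subdivides. A cell of length r <
    delta contributes r^theta <= delta^(theta - 1) r, and the lengths r add up to that of the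
    interval. *)
Lemma part_sum_refine A a b C theta delta a0 s q : 1 < theta -> 0 <= C ->
  almost_additive A a b C theta -> a <= a0 ->
  path <%R a0 s -> path (gap_lt delta) a0 s -> last a0 s <= b ->
  path <%R a0 q -> last a0 q = last a0 s -> {subset s <= q} ->
  `|part_sum A a0 q - part_sum A a0 s|
    <= sewing_const theta * C * delta `^ (theta - 1) * (last a0 s - a0).
Proof.
move=> th C0 hA; elim: s a0 q => [|t s ih] a0 q aa0.
  move=> _ _ _ pq /= lq _; case: q pq lq => [|u q] pq lq.
    by rewrite !subrr normr0 mulr0.
  by have := path_lt_last_gt pq isT; rewrite lq ltxx.
rewrite /= => /andP[a0t pt] /andP[ft fpt] lb pq lq sq.
have tq : t \in q by apply: sq; rewrite mem_head.
case/splitPr: tq pq lq sq => q1 q2; rewrite -cat_rcons => pq.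
rewrite last_cat last_rcons => lq sq.
have pq' := pq; rewrite cat_path last_rcons in pq'; case/andP: pq' => pq1 pq2.
(* The remaining points of [s] exceed [t], whereas those of [q1] are below [t]. *)
have sq2 : {subset s <= q2}.
  move=> r rs; have tr : t < r.
    by move: pt; rewrite path_sortedE; [move=> /andP[/allP h _]; exact: h|exact: lt_trans].
  have := sq r; rewrite inE rs orbT => /(_ isT).
  rewrite mem_cat mem_rcons inE => /orP[/orP[/eqP rt|rq1]|//].
    by rewrite rt ltxx in tr.
  by have := lt_trans tr (path_sub_lt_last pq rq1); rewrite ltxx.
have at_ : a <= t := le_trans aa0 (ltW a0t).
have h2 := ih t q2 at_ pt fpt lb pq2 lq sq2.
have tb : t <= b := le_trans (path_lt_last pt) lb.
have := part_sum_sewing th C0 hA aa0 pq1; rewrite last_rcons => /(_ tb) h1.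
rewrite part_sum_cat last_rcons opprD addrACA.
apply: le_trans (ler_normD _ _) _; apply: le_trans (lerD h1 h2) _.
have K0 : 0 <= sewing_const theta * C by rewrite mulr_ge0// ltW// sewing_const_gt0.
rewrite -[X in _ <= _ * X](subrKA t) [leRHS]mulrDr addrC lerD2l.
rewrite -[leRHS]mulrA ler_wpM2l// (@powR_split _ theta 1)// powRr1; last by rewrite subr_ge0 ltW.
rewrite ler_wpM2r ?subr_ge0 ?(ltW a0t)//.
by apply: powR_le; rewrite ?subr_ge0 ?ltW.
Qed.

Lemma path_lt_common_refinement a b s1 s2 :
  path <%R a s1 -> last a s1 = b -> path <%R a s2 -> last a s2 = b ->
  exists q, [/\ path <%R a q, last a q = b, {subset s1 <= q} & {subset s2 <= q}].
Proof.
move=> p1 l1 p2 l2.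
(* An empty [s1] means [a = b]. Otherwise [b] belongs to [s1], hence to [q], which identifies the
   last point of [q]. *)
have [s1nil|s1nil] := eqVneq s1 [::].
  by exists s2; split=> //; rewrite s1nil.
pose q := sort <=%R (undup (s1 ++ s2)).
have mq r : (r \in q) = (r \in s1) || (r \in s2).
  by rewrite mem_sort mem_undup mem_cat.
have bounds s r : path <%R a s -> last a s = b -> r \in s -> a < r <= b.
  move=> ps <- rs; move: (ps); rewrite path_sortedE; last exact: lt_trans.
  case/andP=> /allP h _; rewrite h //=.
  case/splitPr: rs ps => u v; rewrite cat_path /= last_cat /= => /andP[_ /andP[_]].
  exact: path_lt_last.
have bq r : r \in q -> a < r <= b.
  by rewrite mq => /orP[|]; exact: bounds.
have pq : path <%R a q.
  rewrite path_sortedE; last exact: lt_trans.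
  rewrite sort_lt_sorted undup_uniq andbT; apply/allP => r /bq /andP[]//.
have b1 : b \in q.
  by rewrite mq -l1; case: (s1) s1nil => //= t s _; rewrite mem_last.
exists q; split=> // [|r rs|r rs]; [|by rewrite mq rs|by rewrite mq rs orbT].
apply/eqP; rewrite eq_le; apply/andP; split.
  have /orP[/eqP ->|] : (last a q == a) || (last a q \in q).
    by rewrite -in_cons mem_last.
  - by have /andP[/ltW ab bb] := bq _ b1; exact: le_trans ab bb.
  - by case/bq/andP.
case/splitPr: b1 pq => u v; rewrite cat_path /= last_cat /= => /andP[_ /andP[_]].
exact: path_lt_last.
Qed.

(** Each sum is compared with that over a common refinement, whence the factor 2. *)
Lemma part_sum_close A a b C theta delta s1 s2 : 1 < theta -> 0 <= C ->
  almost_additive A a b C theta ->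
  path <%R a s1 -> path (gap_lt delta) a s1 -> last a s1 = b ->
  path <%R a s2 -> path (gap_lt delta) a s2 -> last a s2 = b ->
  `|part_sum A a s1 - part_sum A a s2|
    <= 2 * (sewing_const theta * C * delta `^ (theta - 1) * (b - a)).
Proof.
move=> th C0 hA p1 f1 l1 p2 f2 l2.
have [q [pq lq sq1 sq2]] := path_lt_common_refinement p1 l1 p2 l2.
have := @part_sum_refine A a b C theta delta a s1 q th C0 hA (lexx _) p1 f1.
rewrite l1 => /(_ (lexx _) pq lq sq1) h1.
have := @part_sum_refine A a b C theta delta a s2 q th C0 hA (lexx _) p2 f2.
rewrite l2 => /(_ (lexx _) pq lq sq2) h2.
rewrite -(subrKA (part_sum A a q)) (le_trans (ler_normD _ _)) // distrC.
by rewrite mulr2n mulrDl !mul1r lerD.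
Qed.

(** Steps of length [delta / 2] keep the gaps strictly below [delta]. This existence is what makes
    the mesh filter proper. *)
Lemma exists_gap_lt_partition a b delta : 0 < delta -> a <= b ->
  exists s, [/\ path <%R a s, last a s = b & path (gap_lt delta) a s].
Proof.
move=> d0 ab.
have [N] : exists N : nat, b - a <= N%:R * (delta / 2).
  exists (Num.truncn ((b - a) / (delta / 2))).+1.
  rewrite -ler_pdivrMr ?divr_gt0 //; apply/ltW/truncnS_gt.
elim: N a ab => [|N ih] a ab.
  rewrite mul0r subr_le0 => ba; exists [::]; split=> //=.
  by apply/eqP; rewrite eq_le ab ba.
rewrite -natr1 mulrDl mul1r => h.
have [ba|ba] := leP (b - a) (delta / 2).
  move: ab; rewrite le_eqVlt => /predU1P[->|ab]; first by exists [::].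
  exists [:: b]; split=> //=; rewrite ?ab // /gap_lt andbT (le_lt_trans ba) //.
  lra.
have h1 : a + delta / 2 <= b by lra.
have h2 : b - (a + delta / 2) <= N%:R * (delta / 2) by lra.
have [s [ps ls fs]] := ih _ h1 h2.
exists (a + delta / 2 :: s); split=> //=; rewrite ?ps ?fs ?andbT ?ltrDl ?divr_gt0//.
by rewrite /gap_lt; lra.
Qed.

End PartitionSums.

(** * The filter of partitions with mesh tending to 0 *)

Section Mesh.
Context {R : realType}.
Implicit Types (a b delta : R) (s : seq R).

(** The maximum in [mesh] has default value 0, which must itself be below [delta]. *)
Lemma mesh_lt a b delta s : 0 < delta -> (mesh a b s < delta) = path (gap_lt delta) a s.
Proof.
move=> d0; apply/bigmax_ltP/(pathP b) => [[_ h] i si|h].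
  exact: (h (Ordinal si) isT).
by split=> // i _; exact: (h i (ltn_ord i)).
Qed.

Lemma mesh_to0_filter a b : a <= b -> ProperFilter (mesh_to0 a b).
Proof.
move=> ab; apply: filter_from_proper; last first.
  move=> delta /= d0; have [s [ps ls fs]] := exists_gap_lt_partition d0 ab.
  by exists s; split; [split=> //; apply/eqP|rewrite mesh_lt].
apply: filter_from_filter; first by exists 1 => /=.
move=> d1 d2 /= d10 d20; exists (Num.min d1 d2) => /=.
  by rewrite lt_min d10.
by move=> s [ps]; rewrite lt_min => /andP[].
Qed.

Lemma near_mesh_to0 a b delta (P : set (seq R)) : 0 < delta ->
  (forall s, path <%R a s -> last a s = b -> path (gap_lt delta) a s -> P s) ->
  \forall s \near mesh_to0 a b, P s.
Proof.
move=> d0 h; exists delta => //= s [[ps /eqP ls]]; rewrite mesh_lt //.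
exact: h.
Qed.

Lemma mesh_to0_ex a b (P : set (seq R)) : (\forall s \near mesh_to0 a b, P s) ->
  exists2 delta, 0 < delta &
    forall s, path <%R a s -> last a s = b -> path (gap_lt delta) a s -> P s.
Proof.
case=> delta /= d0 h; exists delta => // s ps ls fs; apply: h; split.
  by split=> //; apply/eqP.
by rewrite mesh_lt.
Qed.

End Mesh.

(** * Limits of almost additive sums *)

Section Sewing.
Context {R : realType} {V : completeNormedModType R}.
Variables (A : R -> R -> V) (a : R).

Lemma gap_lt_weaken (d1 d2 : R) b s : d1 <= d2 -> path (gap_lt d1) b s -> path (gap_lt d2) b s.
Proof. by move=> d12; apply: sub_path => u v /lt_le_trans; exact. Qed.

Lemma part_sum_cvg b (C theta : R) : 1 < theta -> 0 <= C -> a <= b ->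
  almost_additive A a b C theta ->
  cvg (part_sum A a s @[s --> mesh_to0 a b]).
Proof.
move=> th C0 ab hA; have FF := mesh_to0_filter ab.
apply: cauchy_cvg; apply: cauchy_exP => e e0.
(* The added 1 makes [K] positive and the final inequality strict. *)
pose K := 2 * (sewing_const theta * C * (b - a)) + 1.
have K0 : 0 < K.
  rewrite ltr_wpDl// mulr_ge0// mulr_ge0 ?subr_ge0// mulr_ge0// ltW//.
  exact: sewing_const_gt0.
have th1 : 0 < theta - 1 by rewrite subr_gt0.
have [delta d0 dK] := powR_small th1 (divr_gt0 e0 K0).
have [s [ps ls fs]] := exists_gap_lt_partition d0 ab.
exists (part_sum A a s).
apply: (near_mesh_to0 d0) => q pq lq fq.
rewrite -ball_normE /=; apply: le_lt_trans (part_sum_close th C0 hA ps fs ls pq fq lq) _.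
have p0 : 0 < delta `^ (theta - 1) by exact: powR_gt0.
move: dK; rewrite ler_pdivlMr// => dK.
have -> : 2 * (sewing_const theta * C * delta `^ (theta - 1) * (b - a))
    = delta `^ (theta - 1) * K - delta `^ (theta - 1) by rewrite /K; ring.
lra.
Qed.

(** A fine partition of [[a, s]] followed by one of [[s, t]] is a fine partition of [[a, t]]. The
    sums over [[a, s]] cancel, and the sewing estimate on [[s, t]] alone remains. *)
Lemma lim_part_sum_estimate (s t C theta : R) (Is It : V) :
  1 < theta -> 0 <= C -> a <= s -> s <= t ->
  almost_additive A s t C theta ->
  part_sum A a q @[q --> mesh_to0 a s] --> Is ->
  part_sum A a q @[q --> mesh_to0 a t] --> It ->
  `|It - Is - A s t| <= sewing_const theta * C * (t - s) `^ theta.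
Proof.
move=> th C0 as_ st hA cs ct.
have Fs := mesh_to0_filter as_; have Ft := mesh_to0_filter (le_trans as_ st).
apply/ler_addgt0Pr => e e0.
have e2 : 0 < e / 2 by rewrite divr_gt0.
move/cvgrPdist_lt: cs => /(_ _ e2) /mesh_to0_ex[d1 d10 h1].
move/cvgrPdist_lt: ct => /(_ _ e2) /mesh_to0_ex[d2 d20 h2].
pose delta := Num.min d1 d2.
have d0 : 0 < delta by rewrite lt_min d10.
have [q1 [pq1 lq1 fq1]] := exists_gap_lt_partition d0 as_.
have [q2 [pq2 lq2 fq2]] := exists_gap_lt_partition d0 st.
have w1 : delta <= d1 by rewrite ge_min lexx.
have w2 : delta <= d2 by rewrite ge_min lexx orbT.
have k1 := h1 _ pq1 lq1 (gap_lt_weaken w1 fq1).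
have k2 : `|It - part_sum A a (q1 ++ q2)| < e / 2.
  apply: h2; rewrite ?cat_path ?last_cat lq1 ?pq1 ?lq2//.
  by rewrite (gap_lt_weaken w2 fq1) (gap_lt_weaken w2 fq2).
have := part_sum_sewing th C0 hA (lexx _) pq2; rewrite lq2 => /(_ (lexx _)) k3.
move: k2; rewrite part_sum_cat lq1 => k2.
have -> : It - Is - A s t = (It - (part_sum A a q1 + part_sum A s q2))
     - (Is - part_sum A a q1) + (part_sum A s q2 - A s t).
  rewrite !opprD !opprK !addrA.
  by rewrite [RHS](ACl ((1*4*7)*(2*5)*(3*6))) /= addNr [- _ + _]addNr !addr0.
have t1 := ler_normD (It - (part_sum A a q1 + part_sum A s q2) - (Is - part_sum A a q1))
  (part_sum A s q2 - A s t).
have t2 := ler_normB (It - (part_sum A a q1 + part_sum A s q2)) (Is - part_sum A a q1).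
lra.
Qed.

End Sewing.

(** * Young integrals of Hölder functions *)

Definition hoelder_on {R : realType} {V : normedModType R} (mu a b : R)
    (g : R -> V) (L : R) : Prop :=
  forall s t : R, a <= s -> s <= t -> t <= b -> `|g t - g s| <= L * (t - s) `^ mu.

(* The library has both parents of this structure, but not their join. *)
HB.instance Definition _ (R : realType) (m n : nat) :=
  Uniform_isComplete.Build 'M[R]_(m, n) cauchy_cvg.

Section YoungIntegral.
Context {R : realType} {n d : nat}.
Implicit Types (g : R -> 'M[R]_(n, d)) (x : R -> 'cV[R]_d) (a b : R).

Definition increment g x (u v : R) : 'cV[R]_n := g u *m (x v - x u).

Lemma young_sumE g x a b : young_sum g x a b = part_sum (increment g x) a.
Proof.
apply/funext => s; rewrite /young_sum; elim: s a => [|t s ih] a /=.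
  by rewrite big_ord0.
by rewrite big_ord_recl /= -ih.
Qed.

Lemma mx_norm_entry m p (B : 'M[R]_(m, p)) i j : `|B i j| <= `|B|.
Proof.
rewrite [leRHS]/Num.Def.normr /= mx_normrE.
exact: (le_bigmax _ (fun ij => `|B ij.1 ij.2|) (i, j)).
Qed.

(** The norm is the largest entry, and an entry of the product is a sum of [d] terms. *)
Lemma norm_mulmx (B : 'M[R]_(n, d)) (v : 'cV[R]_d) : `|B *m v| <= d%:R * `|B| * `|v|.
Proof.
rewrite [leLHS]/Num.Def.normr /= mx_normrE; apply/bigmax_leP; split=> [|[i j] _].
  by rewrite !mulr_ge0.
rewrite mxE /=; apply: le_trans (ler_norm_sum _ _ _) _.
rewrite -mulrA mulr_natl -[X in _ *+ X](card_ord d) -sumr_const ler_sum// => k _.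
by rewrite normrM ler_pM// mx_norm_entry.
Qed.

Definition young_integral g x a b : 'cV[R]_n :=
  lim (young_sum g x a b s @[s --> mesh_to0 a b]).

Lemma young_integralE g x a b I : a <= b ->
  is_young_integral g x a b I -> young_integral g x a b = I.
Proof. by move=> ab; have FF := mesh_to0_filter ab => /cvg_lim; apply. Qed.

Lemma is_young_integralB g1 g2 x a b I1 I2 : a <= b ->
  is_young_integral g1 x a b I1 -> is_young_integral g2 x a b I2 ->
  is_young_integral (fun u => g1 u - g2 u) x a b (I1 - I2).
Proof.
move=> ab c1 c2; have FF := mesh_to0_filter ab.
rewrite /is_young_integral.
have -> : young_sum (fun u => g1 u - g2 u) x a b
    = (fun s => young_sum g1 x a b s - young_sum g2 x a b s).
  apply/funext => s; rewrite -sumrB; apply: eq_bigr => i _.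
  by rewrite mulmxBl.
exact: cvgB.
Qed.

Lemma part_sum_eq_in (V : normedModType R) (A1 A2 : R -> R -> V) a0 a b s : a0 <= a ->
  path <%R a s -> last a s <= b ->
  (forall u v, a0 <= u -> u < v -> v <= b -> A1 u v = A2 u v) ->
  part_sum A1 a s = part_sum A2 a s.
Proof.
move=> aa ps lb h; elim: s a aa ps lb => //= t s ih a aa /andP[at_ pt] lb.
rewrite ih//; last exact: le_trans aa (ltW at_).
by rewrite h//; apply: le_trans lb; exact: path_lt_last.
Qed.

(** Young sums evaluate the integrand at left endpoints of cells, so never at [b]. *)
Lemma is_young_integral_eq g1 g2 x a b I : a <= b ->
  (forall u, a <= u -> u < b -> g1 u = g2 u) ->
  is_young_integral g1 x a b I -> is_young_integral g2 x a b I.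
Proof.
move=> ab h; have FF := mesh_to0_filter ab.
apply: cvg_trans; apply: near_eq_cvg; apply: (near_mesh_to0 ltr01) => s ps ls _.
rewrite !young_sumE; apply: (part_sum_eq_in (lexx a) ps (b := b)).
  by rewrite ls.
by move=> u v au uv vb; rewrite /increment h//; exact: lt_le_trans vb.
Qed.

Lemma is_young_integral0 g x a : is_young_integral g x a a 0.
Proof.
have FF := mesh_to0_filter (lexx a).
have : (fun=> 0 : 'cV[R]_n) s @[s --> mesh_to0 a a] --> (0 : 'cV[R]_n) by exact: cvg_cst.
apply: cvg_trans.
apply: near_eq_cvg; apply: (near_mesh_to0 ltr01) => s ps ls _.
case: s ps ls => [|t s] ps ls; first by rewrite young_sumE.
by have := path_lt_last_gt ps isT; rewrite ls ltxx.
Qed.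

(** The defect is a product of an increment of [g] and an increment of [x], so the two Hölder
    exponents add. *)
Lemma increment_almost_additive g x a b (lambda gamma G X : R) :
  0 < lambda -> 0 < gamma -> 0 <= G -> 0 <= X ->
  hoelder_on lambda a b g G -> hoelder_on gamma a b x X ->
  almost_additive (increment g x) a b (d%:R * G * X) (lambda + gamma).
Proof.
move=> l0 g0 G0 X0 hg hx s u t as_ su ut tb.
have -> : increment g x s t - increment g x s u - increment g x u t =
    - ((g u - g s) *m (x t - x u)).
  by rewrite /increment -mulmxBr opprB subrKA -mulmxBl -mulNmx opprB.
rewrite normrN (le_trans (norm_mulmx _ _))// powR_add//.
have -> : d%:R * G * X * ((t - s) `^ lambda * (t - s) `^ gamma)
  = (d%:R * (G * (t - s) `^ lambda)) * (X * (t - s) `^ gamma) by ring.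
have ub : u <= b by exact: le_trans tb.
have au : a <= u by exact: le_trans su.
apply: ler_pM => //.
  rewrite ler_wpM2l// (le_trans (hg _ _ as_ su ub))// ler_wpM2l// powR_le ?subr_ge0 ?lerB//.
  exact: ltW.
rewrite (le_trans (hx _ _ au ut tb))// ler_wpM2l// powR_le ?subr_ge0 ?lerB//.
exact: ltW.
Qed.

Lemma is_young_integral_ex g x a b (lambda gamma G X : R) :
  0 < lambda -> 0 < gamma -> 1 < lambda + gamma -> 0 <= G -> 0 <= X -> a <= b ->
  hoelder_on lambda a b g G -> hoelder_on gamma a b x X ->
  is_young_integral g x a b (young_integral g x a b).
Proof.
move=> l0 g0 lg G0 X0 ab hg hx.
have hA := increment_almost_additive l0 g0 G0 X0 hg hx.
have C0 : 0 <= d%:R * G * X by rewrite !mulr_ge0.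
rewrite /young_integral /is_young_integral young_sumE.
exact: part_sum_cvg lg C0 ab hA.
Qed.

Lemma young_integral_estimate g x a (s t lambda gamma G X : R) Is It :
  0 < lambda -> 0 < gamma -> 1 < lambda + gamma -> 0 <= G -> 0 <= X ->
  a <= s -> s <= t ->
  hoelder_on lambda s t g G -> hoelder_on gamma s t x X ->
  is_young_integral g x a s Is -> is_young_integral g x a t It ->
  `|It - Is - increment g x s t|
    <= sewing_const (lambda + gamma) * (d%:R * G * X) * (t - s) `^ (lambda + gamma).
Proof.
move=> l0 g0 lg G0 X0 as_ st hg hx cs ct.
apply: (@lim_part_sum_estimate _ _ _ a) => //.
- by rewrite !mulr_ge0.
- exact: increment_almost_additive.
- by move: cs; rewrite /is_young_integral young_sumE.
- by move: ct; rewrite /is_young_integral young_sumE.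
Qed.

End YoungIntegral.

(** * Hölder constants, global and local *)

Section HoelderOn.
Context {R : realType} {V : normedModType R}.
Implicit Types (mu a b e L : R) (g : R -> V).

Lemma hoelder_onB mu a b g1 g2 L1 L2 :
  hoelder_on mu a b g1 L1 -> hoelder_on mu a b g2 L2 ->
  hoelder_on mu a b (fun u => g1 u - g2 u) (L1 + L2).
Proof.
move=> h1 h2 s t as_ st tb.
have -> : g1 t - g2 t - (g1 s - g2 s) = (g1 t - g1 s) - (g2 t - g2 s).
  by rewrite !opprB [g2 s - g1 s]addrC addrACA [- g2 t + _]addrC.
by rewrite mulrDl (le_trans (ler_normB _ _))// lerD ?h1 ?h2.
Qed.

Lemma hoelder_on_sub mu a b a' b' g L : a <= a' -> b' <= b ->
  hoelder_on mu a b g L -> hoelder_on mu a' b' g L.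
Proof.
move=> aa bb h s t as_ st tb.
by apply: h => //; [exact: le_trans as_|exact: le_trans bb].
Qed.

Lemma hoelder_on_le mu a b g L L' : L <= L' ->
  hoelder_on mu a b g L -> hoelder_on mu a b g L'.
Proof.
move=> LL h s t as_ st tb; apply: le_trans (h _ _ as_ st tb) _.
by rewrite ler_wpM2r ?powR_ge0.
Qed.

Lemma hoelder_on_eq mu a b g1 g2 L : (forall t, a <= t -> t <= b -> g1 t = g2 t) ->
  hoelder_on mu a b g1 L -> hoelder_on mu a b g2 L.
Proof.
move=> e h s t as_ st tb.
by rewrite -(e s as_ (le_trans st tb)) -(e t (le_trans as_ st) tb) h.
Qed.

Lemma hoelder_on_paste mu a c b g L1 L2 : 0 <= mu -> 0 <= L1 -> 0 <= L2 ->
  a <= c -> c <= b ->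
  hoelder_on mu a c g L1 -> hoelder_on mu c b g L2 -> hoelder_on mu a b g (L1 + L2).
Proof.
move=> mu0 L10 L20 ac cb h1 h2 s t as_ st tb.
have [tc|ct] := leP t c.
  apply: le_trans (h1 _ _ as_ st tc) _.
  by rewrite ler_wpM2r ?powR_ge0// lerDl.
have [cs|sc] := leP c s.
  apply: le_trans (h2 _ _ cs st tb) _.
  by rewrite ler_wpM2r ?powR_ge0// lerDr.
rewrite -(subrKA (g c)) addrC mulrDl (le_trans (ler_normD _ _))// lerD//.
  rewrite (le_trans (h1 _ _ as_ (ltW sc) (lexx _)))// ler_wpM2l//.
  by rewrite powR_le ?lerD2r ?subr_ge0 ?(ltW sc) ?(ltW ct).
rewrite (le_trans (h2 _ _ (lexx _) (ltW ct) tb))// ler_wpM2l//.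
by rewrite powR_le ?lerD2l ?lerN2 ?subr_ge0 ?(ltW sc) ?(ltW ct).
Qed.

Lemma hoelder_on_exponent mu nu a b g L : 0 < nu -> nu < mu -> 0 <= L ->
  hoelder_on mu a b g L -> hoelder_on nu a b g (L * (b - a) `^ (mu - nu)).
Proof.
move=> nu0 numu L0 h s t as_ st tb; apply: le_trans (h _ _ as_ st tb) _.
rewrite (powR_split _ nu0 numu) mulrA ler_wpM2r ?powR_ge0// ler_wpM2l//.
by rewrite powR_le ?subr_ge0// ?lerB// ltW.
Qed.

Lemma hoelder_on_dist mu a b g L t : 0 <= mu -> 0 <= L -> a <= t -> t <= b ->
  hoelder_on mu a b g L -> `|g t - g a| <= L * (b - a) `^ mu.
Proof.
move=> mu0 L0 at_ tb h; apply: le_trans (h _ _ (lexx _) at_ tb) _.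
by rewrite ler_wpM2l// powR_le ?subr_ge0// lerD2r.
Qed.

Definition hoelder_local mu a b e g L : Prop :=
  forall s t, a <= s -> s <= t -> t <= b -> t - s <= e ->
    `|g t - g s| <= L * (t - s) `^ mu.

Lemma hoelder_on_local mu a b e g L : hoelder_on mu a b g L -> hoelder_local mu a b e g L.
Proof. by move=> h s t as_ st tb _; exact: h. Qed.

(** Distant points are joined by at most [k] steps of length at most [e], and each step costs no
    more than L (t - s)^mu. *)
Lemma hoelder_local_on mu a b e g L k : 0 <= mu -> 0 <= L -> 0 < e ->
  b - a <= k%:R * e -> hoelder_local mu a b e g L -> hoelder_on mu a b g (k%:R * L).
Proof.
move=> mu0 L0 e0 ba h s t as_ st tb.
have : t - s <= k%:R * e by apply: le_trans ba; exact: lerB.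
elim: k {ba} t st tb => [|k ih] t st tb.
  rewrite mul0r subr_le0 => ts; have -> : t = s by apply/eqP; rewrite eq_le ts st.
  by rewrite subrr normr0 !mul0r.
rewrite -natr1 !mulrDl !mul1r => tse.
have p0 := powR_ge0 (t - s) mu.
have [small|big] := leP (t - s) e.
  apply: le_trans (h _ _ as_ st tb small) _.
  by rewrite lerDr !mulr_ge0.
have sm : s <= t - e by rewrite lerBrDr -lerBrDl ltW.
have mt : t - e <= t by rewrite gerBl ltW.
have := ih _ sm (le_trans mt tb); rewrite -addrA -opprD (addrC e) opprD addrA lerBlDr.
move=> /(_ tse) h1.
have := h (t - e) t (le_trans as_ sm) mt tb; rewrite opprB addrC subrK => /(_ (lexx _)) h2.
rewrite -(subrKA (g (t - e))) addrC (le_trans (ler_normD _ _))// lerD//.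
  apply: le_trans h1 _; rewrite ler_wpM2l ?mulr_ge0//.
  by apply: powR_le => //; lra.
apply: le_trans h2 _; rewrite ler_wpM2l//; apply: powR_le => //; exact: ltW.
Qed.

Lemma hoelder_norm_le mu a b g L : 0 <= L ->
  hoelder_on mu a b g L -> (hoelder_norm mu a b g <= L%:E)%E.
Proof.
move=> L0 h; rewrite /hoelder_norm ge_max lee_fin L0 /=.
apply: ge_ereal_sup => _ [[s t] /= [sab tab st] <-].
move: sab tab; rewrite !in_itv /= => /andP[as_ sb] /andP[at_ tb].
rewrite lee_fin ler_pdivrMr; last by rewrite powR_gt0// normr_gt0 subr_eq0 eq_sym.
have [le_st|lt_ts] := leP s t; first by rewrite (ger0_norm (x := t - s)) ?subr_ge0// h.
by rewrite distrC [`|t - s|]distrC (ger0_norm (x := s - t)) ?subr_ge0 ?(ltW lt_ts)// h// ltW.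
Qed.

Lemma hoelder_on_norm mu a b g L : 0 < mu ->
  (hoelder_norm mu a b g <= L%:E)%E -> hoelder_on mu a b g L.
Proof.
move=> mu0; rewrite /hoelder_norm ge_max => /andP[_ h] s t as_ st tb.
move: st; rewrite le_eqVlt => /predU1P[<-|st].
  by rewrite !subrr normr0 powR0 ?gt_eqF// mulr0.
have p0 : 0 < (t - s) `^ mu by rewrite powR_gt0// subr_gt0.
rewrite -ler_pdivrMr// -lee_fin; apply: le_trans h; apply: ereal_sup_ubound.
exists (s, t) => /=; last by rewrite (ger0_norm (x := t - s))// subr_ge0 ltW.
rewrite !in_itv /= as_ tb (lt_eqF st) (ltW (le_lt_trans as_ st)).
by rewrite (ltW (lt_le_trans st tb)).
Qed.

Lemma hoelder_on_continuous mu a b g L : 0 < mu -> 0 <= L ->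
  hoelder_on mu a b g L -> {within `[a, b], continuous g}.
Proof.
move=> mu0 L0 h; apply/subspace_continuousP => t; rewrite /= in_itv /= => /andP[at_ tb].
apply/cvgrPdist_le => e e0.
have L1 : 0 < L + 1 by rewrite ltr_wpDl.
have [delta d0 hd] := powR_small mu0 (divr_gt0 e0 L1).
rewrite near_withinE; near=> s; rewrite /= in_itv /= => /andP[as_ sb].
have dts : `|t - s| <= delta by near: s; exact: cvgr_dist_le.
have : `|g t - g s| <= L * `|t - s| `^ mu.
  have [ts|st] := leP t s.
    by rewrite distrC [`|t - s|]distrC (ger0_norm (x := s - t)) ?subr_ge0// h.
  by rewrite (ger0_norm (x := t - s)) ?subr_ge0 ?(ltW st)// h// ltW.
move=> /le_trans; apply; apply: (@le_trans _ _ ((L + 1) * (e / (L + 1)))); last first.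
  by rewrite mulrC divfK ?gt_eqF.
rewrite ler_pM ?powR_ge0 ?lerDl//.
by apply: le_trans hd; rewrite powR_le// ltW.
Unshelve. all: by end_near. Qed.

(** A Hölder bound already implies continuity, so membership in the space reduces to the existence
    of a constant, the form used from here on. *)
Lemma hoelder_spaceP mu a b g : 0 < mu ->
  hoelder_space mu a b g <-> exists2 L, 0 <= L & hoelder_on mu a b g L.
Proof.
move=> mu0; split=> [[_ hfin]|[L L0 h]].
  have h0 : (0 <= hoelder_norm mu a b g)%E by rewrite le_max lexx.
  exists (fine (hoelder_norm mu a b g)); first exact: fine_ge0.
  by apply: hoelder_on_norm => //; rewrite fineK// ge0_fin_numE.
split; first exact: hoelder_on_continuous h.
by apply: le_lt_trans (hoelder_norm_le L0 h) _; rewrite ltry.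
Qed.

Lemma lim_dist_le (u v : nat -> V) (p q : V) (r : R) :
  u k @[k --> \oo] --> p -> v k @[k --> \oo] --> q ->
  (\forall k \near \oo, `|u k - v k| <= r) -> `|p - q| <= r.
Proof.
move=> up vq h; have /cvg_norm c : u k - v k @[k --> \oo] --> p - q by exact: cvgB.
by rewrite -(cvg_lim _ c)//; apply: limr_le => //; apply/cvg_ex; eexists; exact: c.
Qed.

End HoelderOn.

(** * Banach's fixed point argument for the Hölder seminorm *)

Section FixedPoint.
Context {R : realType}.

Lemma div_exp2_lt (C e : R) : 0 < e -> exists k : nat, C / 2 ^+ k < e.
Proof.
move=> e0; exists (Num.truncn (C / e)).+1.
rewrite ltr_pdivrMr ?exprn_gt0// mulrC -ltr_pdivrMr//.
apply: lt_trans (truncnS_gt _) _.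
by rewrite -natrX ltr_nat ltn_expl.
Qed.

Lemma le0_div_exp2 (r C : R) : (forall k : nat, r <= C / 2 ^+ k) -> r <= 0.
Proof.
move=> h; rewrite leNgt; apply/negP => /(div_exp2_lt C)[k].
by rewrite ltNge h.
Qed.

Lemma hoelder_on_trans {V : normedModType R} (mu a b : R) (g1 g2 g3 : R -> V) L1 L2 :
  hoelder_on mu a b (fun u => g1 u - g2 u) L1 ->
  hoelder_on mu a b (fun u => g2 u - g3 u) L2 ->
  hoelder_on mu a b (fun u => g1 u - g3 u) (L1 + L2).
Proof.
move=> h1 h2 s t as_ st tb; rewrite mulrDl.
have -> : g1 t - g3 t - (g1 s - g3 s) =
    (g1 t - g2 t - (g1 s - g2 s)) + (g2 t - g3 t - (g2 s - g3 s)).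
  by rewrite addrACA subrKA -opprD subrKA.
by rewrite (le_trans (ler_normD _ _))// lerD ?h1 ?h2.
Qed.

Variables (V : completeNormedModType R) (mu p b : R).
Variables (B : set (R -> V)) (Gamma : (R -> V) -> R -> V) (v : V).
Hypothesis mu0 : 0 < mu.
Hypothesis B_start : forall z, B z -> z p = v.
Hypothesis B_hoelder :
  forall z, B z -> exists2 L, 0 <= L & hoelder_on mu p b z L.
Hypothesis B_contraction : forall z1 z2 D, 0 <= D -> B z1 -> B z2 ->
  hoelder_on mu p b (fun u => z1 u - z2 u) D ->
  hoelder_on mu p b (fun u => Gamma z1 u - Gamma z2 u) (D / 2).

(** The contraction halves the seminorm of [z1 - z2] as often as desired. [B_start] makes the
    difference vanish at [p], so seminorm 0 forces equality. *)
Lemma hoelder_fixed_point_unique z1 z2 : B z1 -> B z2 ->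
  (forall t, p <= t -> t <= b -> Gamma z1 t = z1 t) ->
  (forall t, p <= t -> t <= b -> Gamma z2 t = z2 t) ->
  forall t, p <= t -> t <= b -> z1 t = z2 t.
Proof.
move=> B1 B2 f1 f2 t pt tb.
have [L1 L10 h1] := B_hoelder B1; have [L2 L20 h2] := B_hoelder B2.
have L0 : 0 <= L1 + L2 by exact: addr_ge0.
have h k : hoelder_on mu p b (fun u => z1 u - z2 u) ((L1 + L2) / 2 ^+ k).
  elim: k => [|k ih]; first by rewrite expr0 divr1; exact: hoelder_onB.
  rewrite exprSr invfM mulrA; apply: hoelder_on_eq (B_contraction _ B1 B2 ih).
    by move=> u pu ub; rewrite f1// f2.
  by rewrite divr_ge0// exprn_ge0.
apply/eqP; rewrite -subr_eq0 -normr_le0.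
apply: (@le0_div_exp2 _ ((L1 + L2) * (b - p) `^ mu)) => k.
have hk0 : 0 <= (L1 + L2) / 2 ^+ k by rewrite divr_ge0// exprn_ge0.
have := hoelder_on_dist (ltW mu0) hk0 pt tb (h k).
by rewrite (B_start B1) (B_start B2) subrr subr0 mulrAC.
Qed.

(** The iterates of [Gamma] converge pointwise, and Hölder bounds pass to pointwise limits. It
    therefore suffices that [B] is closed under pointwise convergence. *)
Lemma hoelder_fixed_point z0 : B z0 -> (forall z, B z -> B (Gamma z)) ->
  (forall (u : nat -> R -> V) z, (forall k, B (u k)) ->
     (forall t, p <= t -> t <= b -> u k t @[k --> \oo] --> z t) -> B z) ->
  exists2 y, B y & forall t, p <= t -> t <= b -> Gamma y t = y t.
Proof.
move=> Bz0 B_stable B_closed.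
pose u k := iter k Gamma z0.
have Bu k : B (u k) by elim: k => //= k; exact: B_stable.
have [L1 L10 h1] := B_hoelder (Bu 0); have [L2 L20 h2] := B_hoelder (Bu 1).
pose D := L1 + L2.
have D0 : 0 <= D by exact: addr_ge0.
have Dk0 k : 0 <= D / 2 ^+ k by rewrite divr_ge0// exprn_ge0.
have DS k : D / 2 ^+ k.+1 = D / 2 ^+ k / 2 by rewrite exprSr invfM mulrA.
have hS k : hoelder_on mu p b (fun r => u k r - u k.+1 r) (D / 2 ^+ k).
  elim: k => [|k ih]; first by rewrite expr0 divr1; exact: hoelder_onB.
  by rewrite DS; exact: (B_contraction (Dk0 k) (Bu k) (Bu k.+1) ih).
(* The geometric series with first term D / 2^k sums to 2 D / 2^k. *)
have hD m k : hoelder_on mu p b (fun r => u k r - u (k + m)%N r) (2 * (D / 2 ^+ k)).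
  elim: m k => [|m ih] k.
    rewrite addn0 => s t _ _ _; rewrite !subrr normr0.
    by rewrite !mulr_ge0 ?powR_ge0.
  have -> : 2 * (D / 2 ^+ k) = D / 2 ^+ k + 2 * (D / 2 ^+ k.+1) by rewrite DS; field.
  by rewrite addnS -addSn; exact: hoelder_on_trans (hS k) (ih _).
pose W := (b - p) `^ mu.
have dist k m t : p <= t -> t <= b -> `|u k t - u (k + m)%N t| <= 2 * D * W / 2 ^+ k.
  move=> pt tb.
  have := hoelder_on_dist (ltW mu0) (mulr_ge0 (ler0n R 2) (Dk0 k)) pt tb (hD m k).
  rewrite !(B_start (Bu _)) subrr subr0 => /le_trans; apply.
  by rewrite -/W !mulrA mulrAC.
have cv t : p <= t -> t <= b -> cvg (u k t @[k --> \oo]).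
  move=> pt tb; apply: cauchy_cvg; apply: cauchy_exP => e e0.
  have [k hk] := div_exp2_lt (2 * D * W) e0.
  exists (u k t), k => // m /= km; rewrite -ball_normE /=.
  by rewrite -(subnKC km) (le_lt_trans (dist _ _ _ pt tb)).
pose y t := lim (u k t @[k --> \oo]).
have By : B y by apply: (B_closed u) => // t pt tb; exact: cv.
have hy k : hoelder_on mu p b (fun r => u k r - y r) (2 * (D / 2 ^+ k)).
  move=> s t ps st tb.
  have pt := le_trans ps st; have sb := le_trans st tb.
  apply: (@lim_dist_le _ _ (fun m => u k t - u m t) (fun m => u k s - u m s)).
  - by apply: cvgB; [exact: cvg_cst|exact: cv].
  - by apply: cvgB; [exact: cvg_cst|exact: cv].
  - by exists k => // m /= km; rewrite -(subnKC km) hD.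
(* Both [Gamma y] and [y] are within D W / 2^k of the iterate [u k.+1]: the first by contraction,
   the second by [hy]. *)
exists y => // t pt tb; apply/eqP; rewrite -subr_eq0 -normr_le0.
apply: (@le0_div_exp2 _ (2 * (D * W))) => k.
have k2 : 0 <= 2 * (D / 2 ^+ k) by rewrite mulr_ge0.
have := hoelder_on_dist (ltW mu0) (mulr_ge0 (ler0n R 2) (Dk0 k.+1)) pt tb (hy k.+1).
have := B_contraction k2 (Bu k) By (hy k).
move=> /(hoelder_on_dist (ltW mu0) (divr_ge0 k2 (ler0n R 2)) pt tb).
have -> : Gamma (u k) = u k.+1 by [].
rewrite !(B_start (Bu _)) (B_start By) (B_start (B_stable _ By)) !subrr !subr0.
rewrite distrC => l1 l2.
rewrite -(subrKA (u k.+1 t)) (le_trans (ler_normD _ _))// (le_trans (lerD l1 l2))//.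
rewrite DS -/W le_eqVlt; apply/orP; left; apply/eqP; field.
by rewrite expf_neq0.
Qed.

End FixedPoint.

(** * Increments of the Young integral on short intervals *)

Section YoungIncrement.
Context {R : realType} {n d : nat}.
Variables (g : R -> 'M[R]_(n, d)) (x : R -> 'cV[R]_d).

(** The one-term sum has order [gamma] and the remainder order [lambda + gamma]. Only the power
    [lambda] of [t - s] is kept; the surplus powers are bounded by powers of [e] and become small
    with [e]. *)
Lemma young_increment_le (a s t lambda gamma G X N e : R) (Is It : 'cV[R]_n) :
  0 < lambda -> lambda < gamma -> 1 < lambda + gamma -> 0 <= G -> 0 <= X ->
  a <= s -> s <= t -> t - s <= e -> `|g s| <= N ->
  hoelder_on lambda s t g G -> hoelder_on gamma s t x X ->
  is_young_integral g x a s Is -> is_young_integral g x a t It ->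
  `|It - Is| <= (d%:R * N * X * e `^ (gamma - lambda)
    + sewing_const (lambda + gamma) * (d%:R * G * X) * e `^ gamma) * (t - s) `^ lambda.
Proof.
move=> l0 lg th G0 X0 as_ st tse gN hg hx cs ct.
have g0 : 0 < gamma by exact: lt_trans lg.
have ts0 : 0 <= t - s by rewrite subr_ge0.
have h1 := young_integral_estimate l0 g0 th G0 X0 as_ st hg hx cs ct.
have N0 : 0 <= N by exact: le_trans gN.
have h2 : `|increment g x s t| <= d%:R * N * X * e `^ (gamma - lambda) * (t - s) `^ lambda.
  rewrite (le_trans (norm_mulmx _ _))//.
  have hx' := hx _ _ (lexx _) st (lexx _).
  apply: (@le_trans _ _ (d%:R * N * (X * (t - s) `^ gamma))).
    by apply: ler_pM => //; rewrite ler_wpM2l.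
  rewrite (powR_split _ l0 lg) !mulrA ler_wpM2r ?powR_ge0// ler_wpM2l ?mulr_ge0//.
  by apply: powR_le => //; rewrite subr_ge0 ltW.
rewrite -(subrK (increment g x s t) (It - Is)) (le_trans (ler_normD _ _))//.
rewrite mulrDl addrC lerD//; apply: le_trans h1 _.
rewrite powR_add// [(t - s) `^ lambda * _]mulrC [leLHS]mulrA ler_wpM2r ?powR_ge0//.
rewrite ler_wpM2l//; last by apply: powR_le => //; exact: ltW.
by rewrite mulr_ge0 ?(ltW (sewing_const_gt0 th))// !mulr_ge0.
Qed.

End YoungIncrement.

(** * From local to global Hölder bounds on short intervals *)

Section LocalHoelder.
Context {R : realType} {V : normedModType R}.
Implicit Types (mu a b e L : R) (g : R -> V).

Lemma hoelder_local_wide mu a b e g L : b - a <= e ->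
  hoelder_local mu a b e g L -> hoelder_on mu a b g L.
Proof.
move=> bae h s t as_ st tb; apply: h => //.
by apply: le_trans bae; exact: lerB.
Qed.

Lemma hoelder_local_at mu a b e g L s t : a <= s -> t <= b -> t - s <= e ->
  hoelder_local mu a b e g L -> hoelder_on mu s t g L.
Proof.
move=> as_ tb ts h s' t' ss st tt.
apply: h => //; [exact: le_trans as_ ss|exact: le_trans tt tb|].
by apply: le_trans ts; exact: lerB.
Qed.

End LocalHoelder.

(** * The delay map and the Picard map *)

Section DelayEquation.
Context {R : realType} {n d : nat}.
Variables (T h gamma lambda : R) (x : R -> 'cV[R]_d) (xi : R -> 'cV[R]_n).
Variable f : (R -> 'cV[R]_n) -> 'M[R]_(n, d).
Implicit Types (z : R -> 'cV[R]_n) (a b e D L N : R).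
Hypotheses (h0 : 0 < h) (lambda_gt : 1 / 2 < lambda) (lambda_gamma : lambda < gamma).

Let lambda0 : 0 < lambda. Proof. by have l := lambda_gt; lra. Qed.
Let gamma0 : 0 < gamma. Proof. exact: lt_trans lambda_gamma. Qed.
Let theta1 : 1 < lambda + gamma.
Proof. by have l := lambda_gt; have lg := lambda_gamma; lra. Qed.

Lemma segment_hoelder b t z L : 0 <= L -> 0 <= t -> t <= b ->
  hoelder_on lambda (- h) b z L -> hoelder_space lambda (- h) 0 (segment z t).
Proof.
move=> L0 t0 tb hz; apply/hoelder_spaceP => //; exists L => // s u hs su u0.
have -> : u - s = (t + u) - (t + s) by lra.
by apply: hz; lra.
Qed.

Section BoundedLipschitz.
Variable M : R.
Hypothesis M0 : 0 <= M.
Hypothesis f_bounded : forall zeta, hoelder_space lambda (- h) 0 zeta -> `|f zeta| <= M.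
Hypothesis f_lipschitz : forall zeta1 zeta2,
  hoelder_space lambda (- h) 0 zeta1 -> hoelder_space lambda (- h) 0 zeta2 ->
  ((`|f zeta2 - f zeta1|)%:E <= M%:E * sup_dist (- h) 0 zeta1 zeta2)%E.

(** Function and time vary together: one function at two times yields Hölder bounds for the delay
    map, two functions at one time yield its dependence on the past only. *)
Lemma delay_map_dist b1 b2 z1 z2 L1 L2 s t r : 0 <= L1 -> 0 <= L2 ->
  0 <= s -> s <= b1 -> 0 <= t -> t <= b2 ->
  hoelder_on lambda (- h) b1 z1 L1 -> hoelder_on lambda (- h) b2 z2 L2 ->
  (forall u, - h <= u -> u <= 0 -> `|z2 (t + u) - z1 (s + u)| <= r) ->
  `|delay_map f z2 t - delay_map f z1 s| <= M * r.
Proof.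
move=> L10 L20 s0 sb t0 tb hz1 hz2 hr.
have S1 := segment_hoelder L10 s0 sb hz1; have S2 := segment_hoelder L20 t0 tb hz2.
rewrite -lee_fin EFinM (le_trans (f_lipschitz S1 S2))//.
apply: lee_wpmul2l; first by rewrite lee_fin.
apply: ge_ereal_sup => _ [u /= + <-]; rewrite in_itv /= => /andP[hu u0].
by rewrite lee_fin hr.
Qed.

Lemma delay_map_eq a b z1 z2 L1 L2 t : 0 <= L1 -> 0 <= L2 -> 0 <= t -> t <= a -> t <= b ->
  hoelder_on lambda (- h) a z1 L1 -> hoelder_on lambda (- h) b z2 L2 ->
  (forall u, - h <= u -> u <= t -> z1 u = z2 u) ->
  delay_map f z1 t = delay_map f z2 t.
Proof.
move=> L10 L20 t0 ta tb hz1 hz2 e.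
apply/eqP; rewrite eq_sym -subr_eq0 -normr_le0 -(mulr0 M).
apply: (delay_map_dist L10 L20 t0 ta t0 tb hz1 hz2) => u hu u0.
by rewrite e ?subrr ?normr0//; lra.
Qed.

Lemma delay_map_bounded b z L t : 0 <= L -> 0 <= t -> t <= b ->
  hoelder_on lambda (- h) b z L -> `|delay_map f z t| <= M.
Proof. by move=> L0 t0 tb hz; apply: f_bounded; exact: segment_hoelder hz. Qed.

(** Between times [s] and [t] every point of the segment moves by [t - s], so the scale [e] is
    preserved. The global constant [L'] places the segments in the domain where [f] is controlled
    and does not enter the bound. *)
Lemma delay_map_local b e z L L' : 0 <= L -> 0 <= L' ->
  hoelder_on lambda (- h) b z L' -> hoelder_local lambda (- h) b e z L ->
  hoelder_local lambda 0 b e (delay_map f z) (M * L).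
Proof.
move=> L0 L'0 hz hl s t s0 st tb tse; rewrite -mulrA.
have sb := le_trans st tb; have t0 := le_trans s0 st.
apply: (delay_map_dist L'0 L'0 s0 sb t0 tb hz hz) => u hu u0.
have -> : t - s = (t + u) - (s + u) by lra.
by apply: hl; lra.
Qed.

Lemma delay_map_hoelder b z L : 0 <= L ->
  hoelder_on lambda (- h) b z L -> hoelder_on lambda 0 b (delay_map f z) (M * L).
Proof.
move=> L0 hz; apply: (hoelder_local_wide (lexx _)).
exact: (delay_map_local L0 L0 hz (hoelder_on_local hz)).
Qed.

Variable X : R.
Hypotheses (X0 : 0 <= X) (x_hoelder : hoelder_on gamma 0 T x X).

(** At 0 the integral vanishes, so the two branches fit together there. *)
Definition picard z (t : R) : 'cV[R]_n :=
  if t < 0 then xi t else xi 0 + young_integral (delay_map f z) x 0 t.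

Lemma delay_map_integral b z L t : 0 <= L -> 0 <= t -> t <= b -> b <= T ->
  hoelder_on lambda (- h) b z L ->
  is_young_integral (delay_map f z) x 0 t (young_integral (delay_map f z) x 0 t).
Proof.
move=> L0 t0 tb bT hz.
apply: (is_young_integral_ex lambda0 gamma0 theta1 _ X0 t0).
- by apply: (mulr_ge0 M0 L0).
- by apply: (hoelder_on_sub (lexx _) tb); exact: delay_map_hoelder.
- by apply: (hoelder_on_sub (lexx _) _ x_hoelder); exact: le_trans bT.
Qed.

Lemma picard_neg z t : t <= 0 -> picard z t = xi t.
Proof.
rewrite /picard; case: ltgtP => // -> _.
by rewrite (young_integralE (lexx 0) (is_young_integral0 _ _ _)) addr0.
Qed.

(** Causality: the integrand at times before [t] sees its argument only up to [t]. *)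
Lemma picard_eq a b z1 z2 L1 L2 : a <= T -> b <= T -> 0 <= L1 -> 0 <= L2 ->
  hoelder_on lambda (- h) a z1 L1 -> hoelder_on lambda (- h) b z2 L2 ->
  forall t, t <= a -> t <= b ->
  (forall u, - h <= u -> u <= t -> z1 u = z2 u) -> picard z1 t = picard z2 t.
Proof.
move=> aT bT L10 L20 hz1 hz2 t ta tb e.
have [t0|t0] := ltP t 0; first by rewrite !picard_neg// ltW.
rewrite /picard ltNge t0 /=; congr (_ + _); apply/esym.
apply: (young_integralE t0).
apply: is_young_integral_eq (delay_map_integral L10 t0 ta aT hz1) => // u u0 ut.
have ua := le_trans (ltW ut) ta; have ub := le_trans (ltW ut) tb.
apply: (delay_map_eq L10 L20 u0 ua ub hz1 hz2) => v hv vu.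
by apply: e => //; exact: le_trans vu (ltW ut).
Qed.

(** If the delay map multiplies Hölder constants by [c], the Picard map at scale [e] multiplies them
    by this factor, up to an additive term. It is used with [c = M] for stability and with the
    constant of condition (ii) for contraction. *)
Definition picard_rate (c e : R) : R :=
  (1 + sewing_const (lambda + gamma)) * d%:R * X * c * e `^ gamma.

Lemma picard_rate_ge0 c e : 0 <= c -> 0 <= picard_rate c e.
Proof.
move=> c0; rewrite !mulr_ge0 ?powR_ge0// addr_ge0// ltW//.
exact: sewing_const_gt0.
Qed.

(** The bound is affine in the local constant [L] and free of [L'], so the scale can be fixed before
    any ball is chosen. *)
Lemma picard_local b e z L L' : 0 <= L -> 0 <= L' -> b <= T ->
  hoelder_on lambda (- h) b z L' -> hoelder_local lambda (- h) b e z L ->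
  hoelder_local lambda 0 b e (picard z)
    (d%:R * M * X * e `^ (gamma - lambda) + picard_rate M e * L).
Proof.
move=> L0 L'0 bT hz hl s t s0 st tb tse.
have sb := le_trans st tb; have t0 := le_trans s0 st.
rewrite /picard !ltNge s0 t0 /= opprD addrACA subrr add0r.
have ML0 := mulr_ge0 M0 L0.
apply: le_trans (young_increment_le lambda0 lambda_gamma theta1 ML0 X0 s0 st tse
  (delay_map_bounded L'0 s0 sb hz) _ _ (delay_map_integral L'0 s0 sb bT hz)
  (delay_map_integral L'0 t0 tb bT hz)) _.
- exact: hoelder_local_at s0 tb tse (delay_map_local L0 L'0 hz hl).
- exact: hoelder_on_sub s0 (le_trans tb bT) x_hoelder.
rewrite ler_wpM2r ?powR_ge0// lerD2l.
have -> : picard_rate M e * L = d%:R * X * M * e `^ gamma * L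
    + sewing_const (lambda + gamma) * (d%:R * (M * L) * X) * e `^ gamma.
  by rewrite /picard_rate; ring.
by rewrite lerDr !mulr_ge0 ?powR_ge0.
Qed.

(** By causality the images agree up to [a]. Beyond [a] their difference is the Young integral of
    the difference of the delay maps, to which [young_increment_le] applies. *)
Lemma picard_contraction c a b e z1 z2 N D : 0 <= c -> 0 <= N -> 0 <= D ->
  0 <= a -> a <= b -> b <= T -> b - a <= e ->
  hoelder_on lambda (- h) b z1 N -> hoelder_on lambda (- h) b z2 N ->
  (forall t, - h <= t -> t <= a -> z1 t = z2 t) ->
  hoelder_on lambda a b (fun s => delay_map f z1 s - delay_map f z2 s) (c * D) ->
  hoelder_on lambda (- h) b (fun s => picard z1 s - picard z2 s) (picard_rate c e * D).
Proof.
move=> c0 N0 D0 a0 ab bT bae hz1 hz2 z12 hw.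
have rate0 : 0 <= picard_rate c e * D by rewrite mulr_ge0// picard_rate_ge0.
rewrite -(add0r (picard_rate c e * D)).
have ha : - h <= a by have hp := h0; lra.
apply: (hoelder_on_paste (ltW lambda0) (lexx 0) rate0 ha ab) => s t as_ st tb.
  have E u : u <= a -> picard z1 u - picard z2 u = 0.
    move=> ua; have ub := le_trans ua ab.
    apply/eqP; rewrite subr_eq0; apply/eqP.
    apply: (picard_eq bT bT N0 N0 hz1 hz2 ub ub) => v hv vu.
    by apply: z12 => //; exact: le_trans vu ua.
  by rewrite !E ?subrr ?normr0 ?mul0r//; exact: le_trans st tb.
have s0 := le_trans a0 as_; have t0 := le_trans s0 st.
have sb := le_trans st tb; have at_ := le_trans as_ st.
have E u : 0 <= u -> picard z1 u - picard z2 u =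
    young_integral (delay_map f z1) x 0 u - young_integral (delay_map f z2) x 0 u.
  by move=> u0; rewrite /picard ltNge u0 /= opprD addrACA subrr add0r.
have cD0 := mulr_ge0 c0 D0.
have wa : delay_map f z1 a - delay_map f z2 a = 0.
  by rewrite (delay_map_eq N0 N0 a0 ab ab hz1 hz2) ?subrr.
(* The difference of the delay maps vanishes at [a], so its Hölder bound also makes its values
   small; this leaves no additive term. *)
have ws : `|delay_map f z1 s - delay_map f z2 s| <= c * D * e `^ lambda.
  have := hw a s (lexx _) as_ sb; rewrite wa subr0 => /le_trans; apply.
  by rewrite ler_wpM2l//; apply: powR_le; [exact: ltW|lra|lra].
have tse : t - s <= e by lra.
rewrite !E//; apply: le_trans (young_increment_le
  (g := fun u => delay_map f z1 u - delay_map f z2 u)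
  lambda0 lambda_gamma theta1 cD0 X0 s0 st tse ws _ _
  (is_young_integralB s0 (delay_map_integral N0 s0 sb bT hz1) (delay_map_integral N0 s0 sb bT hz2))
  (is_young_integralB t0 (delay_map_integral N0 t0 tb bT hz1) (delay_map_integral N0 t0 tb bT hz2))) _.
- exact: hoelder_on_sub as_ tb hw.
- exact: hoelder_on_sub s0 (le_trans tb bT) x_hoelder.
rewrite ler_wpM2r ?powR_ge0//.
have eg : e `^ gamma = e `^ lambda * e `^ (gamma - lambda).
  by rewrite (powR_split _ lambda0 lambda_gamma) mulrC.
by rewrite /picard_rate eg le_eqVlt; apply/orP; left; apply/eqP; ring.
Qed.


Lemma picard_rate_small c : 0 <= c -> exists2 e, 0 < e & picard_rate c e <= 1 / 2.
Proof.
move=> c0; pose K := (1 + sewing_const (lambda + gamma)) * d%:R * X * c.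
have K0 : 0 <= K.
  by rewrite !mulr_ge0// addr_ge0// ltW// sewing_const_gt0.
have K1 : 0 < 2 * (K + 1) by rewrite mulr_gt0// ltr_wpDl.
have [e e0 he] := powR_small gamma0 (divr_gt0 (ltr01 : 0 < 1 :> R) K1).
exists e => //; rewrite /picard_rate -/K.
apply: le_trans (ler_wpM2l K0 he) _.
by rewrite mulrA mulr1 ler_pdivrMr//; lra.
Qed.

(** Condition (ii) in terms of Hölder constants, with bounds required on all of [[- h, b]] instead
    of [[a - h, b]]. *)
Definition delay_map_lipschitz N c : Prop :=
  forall a b z1 z2 D, 0 <= D -> 0 <= a -> a <= b -> b <= T ->
  hoelder_on lambda (- h) b z1 N -> hoelder_on lambda (- h) b z2 N ->
  (forall t, - h <= t -> t <= a -> z1 t = z2 t) ->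
  hoelder_on lambda (- h) b (fun s => z1 s - z2 s) D ->
  hoelder_on lambda a b (fun s => delay_map f z1 s - delay_map f z2 s) (c * D).

Lemma delay_map_lipschitz_ex N : 1 <= N ->
  locally_lipschitz_delay_map f T h lambda ->
  exists2 c, 0 <= c & delay_map_lipschitz N c.
Proof.
move=> N1 /(_ N N1)[c c0 hc]; exists c; first exact: ltW.
move=> a b z1 z2 D D0 a0 ab bT hz1 hz2 e hD.
have N0 : 0 <= N by exact: le_trans N1.
have ha : - h <= a - h by lra.
have sub1 := hoelder_on_sub ha (lexx b) hz1.
have sub2 := hoelder_on_sub ha (lexx b) hz2.
have sp1 : hoelder_space lambda (a - h) b z1 by apply/hoelder_spaceP => //; exists N.
have sp2 : hoelder_space lambda (a - h) b z2 by apply/hoelder_spaceP => //; exists N.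
have rho : hoelder_space lambda (a - h) a z1.
  apply/hoelder_spaceP => //; exists N => //.
  exact: hoelder_on_sub (lexx _) ab sub1.
apply: hoelder_on_norm => //.
(* [z1] itself serves as the common initial path. *)
apply: (le_trans (hc a b a0 ab bT z1 rho z1 z2 _ _ _)).
- by split.
- split=> // t; rewrite in_itv /= => /andP[aht ta].
  by rewrite e//; exact: le_trans aht.
- by rewrite ge_max !hoelder_norm_le.
rewrite EFinM lee_wpmul2l//; first by rewrite lee_fin ltW.
by apply: hoelder_norm_le => //; exact: hoelder_on_sub ha (lexx b) hD.
Qed.

Lemma step_ind (P : R -> Prop) e : 0 < e -> 0 <= T -> P 0 ->
  (forall a b, 0 <= a -> a <= b -> b <= T -> b - a <= e -> P a -> P b) -> P T.
Proof.
move=> e0 T0 P0 PS.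
have step k : P (Num.min (k%:R * e) T).
  elim: k => [|k ih]; first by rewrite mul0r min_l.
  apply: PS ih.
  - by rewrite le_min T0 andbT mulr_ge0// ltW.
  - by rewrite le_min ge_min ge_min lexx orbT andbT ler_wpM2r ?(ltW e0)// ler_nat leqnSn.
  - by rewrite ge_min lexx orbT.
  - rewrite lerBlDr -natr1 mulrDl mul1r.
    have [_|_] := leP (k%:R * e) T; first by rewrite ge_min addrC lexx.
    by rewrite ge_min lerDr (ltW e0) orbT.
have := step (Num.truncn (T / e)).+1; rewrite min_r//.
by rewrite -ler_pdivrMr// ltW// truncnS_gt.
Qed.

Lemma picard_unique c e N y1 y2 : 0 <= c -> 0 < e -> 0 <= N -> 0 <= T ->
  delay_map_lipschitz N c -> picard_rate c e <= 1 / 2 ->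
  hoelder_on lambda (- h) T y1 N -> hoelder_on lambda (- h) T y2 N ->
  (forall t, - h <= t -> t <= T -> picard y1 t = y1 t) ->
  (forall t, - h <= t -> t <= T -> picard y2 t = y2 t) ->
  forall t, - h <= t -> t <= T -> y1 t = y2 t.
Proof.
move=> c0 e0 N0 T0 hc rate h1 h2 f1 f2.
pose P a := forall t, - h <= t -> t <= a -> y1 t = y2 t.
apply: (@step_ind P e e0 T0) => [t ht t0|a b a0 ab bT bae Pa t ht tb].
  by rewrite -f1 ?(le_trans t0)// -f2 ?(le_trans t0)// !picard_neg.
(* Both solutions lie in this set once they agree up to [a], and the Picard map contracts on it. *)
pose B := [set z | hoelder_on lambda (- h) b z N /\
                   forall t, - h <= t -> t <= a -> z t = y1 t].
have hp := h0.
have sub y : hoelder_on lambda (- h) T y N -> hoelder_on lambda (- h) b y N.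
  exact: hoelder_on_sub (lexx _) bT.
apply: (hoelder_fixed_point_unique (B := B) (v := y1 (- h)) (Gamma := picard) (p := - h) (b := b)
  lambda0 _ _ _ (z1 := y1) (z2 := y2)) => //.
- by move=> z [_ ->]//; lra.
- by move=> z [hz _]; exists N.
- move=> z1 z2 D D0 [hz1 e1] [hz2 e2] hD.
  have e12 u : - h <= u -> u <= a -> z1 u = z2 u by move=> hu ua; rewrite e1 ?e2.
  have hw := hc a b z1 z2 D D0 a0 ab bT hz1 hz2 e12 hD.
  apply: hoelder_on_le (picard_contraction c0 N0 D0 a0 ab bT bae hz1 hz2 e12 hw).
  by rewrite (le_trans (ler_wpM2r D0 rate))// mulrC mulrA mulr1.
- by split=> //; exact: sub.
- by split=> [|u hu ua]; [exact: sub|rewrite Pa].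
- by move=> u hu ub; apply: f1 => //; exact: le_trans bT.
- by move=> u hu ub; apply: f2 => //; exact: le_trans bT.
Qed.

(** * A stable ball and the continuation of solutions *)

Section Ball.
Variables (e0 Xi : R).
Hypotheses (e0_gt0 : 0 < e0) (e0_rate : picard_rate M e0 <= 1 / 2).
Hypotheses (Xi0 : 0 <= Xi) (xi_hoelder : hoelder_on lambda (- h) 0 xi Xi).

(** The solution r of Xi + d M X e0^(gamma - lambda) + r / 2 = r, where r / 2 comes from the rate at
    scale [e0]. *)
Definition radius : R := 2 * (Xi + d%:R * M * X * e0 `^ (gamma - lambda)).

Lemma radius_ge0 : 0 <= radius.
Proof. by rewrite mulr_ge0// addr_ge0// !mulr_ge0 ?powR_ge0. Qed.

(* Since the Hoelder bound is local, with a scale that does not depend on b,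
   this set is stable under the Picard map for every b <= T. *)
Definition picard_ball b z : Prop :=
  hoelder_local lambda (- h) b e0 z radius /\
  forall t, - h <= t -> t <= 0 -> z t = xi t.

Lemma picard_ball_hoelder : exists2 N, 1 <= N &
  forall b z, b <= T -> picard_ball b z -> hoelder_on lambda (- h) b z N.
Proof.
(* [k] steps of length [e0] cover [[- h, T]], whatever [b] is. The 1 added to the bound gives
   [1 <= N], as condition (ii) demands. *)
pose k := (Num.truncn ((T + h) / e0)).+1.
exists (k%:R * radius + 1); first by rewrite lerDr mulr_ge0// radius_ge0.
move=> b z bT [hz _]; apply: (@hoelder_on_le _ _ _ _ _ _ (k%:R * radius)).
  by rewrite lerDl.
apply: (hoelder_local_on (ltW lambda0) radius_ge0 e0_gt0 _ hz).
rewrite opprK -ler_pdivrMr//; apply: le_trans (ltW (truncnS_gt _)).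
by rewrite ler_wpM2r ?invr_ge0 ?(ltW e0_gt0)// lerD2r.
Qed.

(** A pair on both sides of 0 costs the constant of [xi] plus that of [picard_local], and [radius]
    is chosen to absorb the sum. *)
Lemma picard_ball_stable b z : b <= T -> picard_ball b z -> picard_ball b (picard z).
Proof.
move=> bT Bz; split; last by move=> t _ t0; rewrite picard_neg.
have [N N1 hN] := picard_ball_hoelder; have hz := hN b z bT Bz.
have N0 : 0 <= N by exact: le_trans N1.
have R0 := radius_ge0.
have hl := picard_local R0 N0 bT hz Bz.1.
set Q := d%:R * M * X * e0 `^ (gamma - lambda) + picard_rate M e0 * radius in hl.
have Q0 : 0 <= Q.
  by rewrite addr_ge0// mulr_ge0 ?powR_ge0 ?picard_rate_ge0// !mulr_ge0.
have Qle : Xi + Q <= radius.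
  have := ler_wpM2r R0 e0_rate; rewrite /Q.
  by move: (picard_rate M e0 * radius) => q; rewrite /radius; lra.
have hneg : hoelder_on lambda (- h) 0 (picard z) Xi.
  by apply: hoelder_on_eq xi_hoelder => t _ t0; rewrite picard_neg.
move=> s t hs st tb tse.
suff H : hoelder_on lambda s t (picard z) (Xi + Q).
  by apply: le_trans (H _ _ (lexx _) st (lexx _)) _; rewrite ler_wpM2r ?powR_ge0.
have [t0|t0] := leP t 0.
  apply: hoelder_on_le (hoelder_on_sub hs t0 hneg); by rewrite lerDl.
have [s0|s0] := leP 0 s.
  apply: (@hoelder_on_le _ _ _ _ _ _ Q); first by rewrite lerDr.
  exact: hoelder_local_at s0 tb tse hl.
apply: (hoelder_on_paste (ltW lambda0) Xi0 Q0 (ltW s0) (ltW t0)).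
  exact: hoelder_on_sub hs (lexx _) hneg.
apply: (hoelder_local_at (lexx 0) tb _ hl); lra.
Qed.

Lemma picard_extend c e N a b y : 0 <= c -> 0 <= N ->
  delay_map_lipschitz N c -> picard_rate c e <= 1 / 2 ->
  (forall b z, b <= T -> picard_ball b z -> hoelder_on lambda (- h) b z N) ->
  0 <= a -> a <= b -> b <= T -> b - a <= e -> picard_ball a y ->
  (forall t, - h <= t -> t <= a -> picard y t = y t) ->
  exists2 y', picard_ball b y' & forall t, - h <= t -> t <= b -> picard y' t = y' t.
Proof.
move=> c0 N0 hc rate hN a0 ab bT bae By fy.
pose B := [set z | picard_ball b z /\ forall t, - h <= t -> t <= a -> z t = y t].
have aT := le_trans ab bT.
have hp := h0.
have hy := hN a y aT By.
suff [y' [By' _] fy'] : exists2 y', B y' &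
    forall t, - h <= t -> t <= b -> picard y' t = y' t by exists y'.
(* The iteration starts from [y] frozen at its value at [a], which does not increase the local
   Hölder constant. *)
apply: (hoelder_fixed_point (B := B) (v := y (- h)) lambda0 _ _ _
  (z0 := fun t => y (Num.min t a))).
- by move=> z [_ ->]//; lra.
- by move=> z [Bz _]; exists N => //; exact: hN.
- move=> z1 z2 D D0 [Bz1 e1] [Bz2 e2] hD.
  have hz1 := hN b z1 bT Bz1; have hz2 := hN b z2 bT Bz2.
  have e12 u : - h <= u -> u <= a -> z1 u = z2 u by move=> hu ua; rewrite e1 ?e2.
  have hw := hc a b z1 z2 D D0 a0 ab bT hz1 hz2 e12 hD.
  apply: hoelder_on_le (picard_contraction c0 N0 D0 a0 ab bT bae hz1 hz2 e12 hw).
  by rewrite (le_trans (ler_wpM2r D0 rate))// mulrC mulrA mulr1.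
- split; last by move=> t _ ta; rewrite min_l.
  split; last by move=> t ht t0; rewrite min_l ?By.2//; exact: le_trans a0.
  move=> s t hs st tb tse.
  have R0 := radius_ge0.
  have [ta|at_] := leP t a.
    by rewrite min_l ?(le_trans st)//; exact: By.1.
  have [sa|as_] := leP s a; last first.
    by rewrite subrr normr0 mulr_ge0 ?powR_ge0.
  apply: le_trans (By.1 s a hs sa (lexx _) _) _; first lra.
  rewrite ler_wpM2l//; apply: powR_le; [exact: ltW|lra|lra].
(* Causality and the fixed point property of [y] keep the image equal to [y] up to [a]. *)
- move=> z [Bz ez]; split; first exact: picard_ball_stable.
  move=> t ht ta; rewrite -fy//.
  apply: (picard_eq bT aT N0 N0 (hN b z bT Bz) hy (le_trans ta ab) ta) => u hu ut.
  by apply: ez => //; exact: le_trans ta.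
- move=> u z Bu uz; split.
    split.
      move=> s t hs st tb tse; apply: (@lim_dist_le _ _ (u ^~ t) (u ^~ s)).
      + by apply: uz => //; exact: le_trans hs st.
      + by apply: uz => //; exact: le_trans st tb.
      + by apply: nearW => k; exact: (Bu k).1.1.
    move=> t ht t0.
    apply: (@norm_cvg_unique _ _ (u k t @[k --> \oo])).
      by apply: uz => //; apply: le_trans t0 _; exact: le_trans ab.
    rewrite /= (_ : u ^~ t = fun=> xi t); first exact: cvg_cst.
    by apply/funext => k; exact: (Bu k).1.2.
  move=> t ht ta.
  apply: (@norm_cvg_unique _ _ (u k t @[k --> \oo])).
    by apply: uz => //; exact: le_trans ta ab.
  rewrite /= (_ : u ^~ t = fun=> y t); first exact: cvg_cst.
  by apply/funext => k; exact: (Bu k).2.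
Qed.

Lemma picard_exists : 0 <= T -> locally_lipschitz_delay_map f T h lambda ->
  exists2 y, picard_ball T y & forall t, - h <= t -> t <= T -> picard y t = y t.
Proof.
move=> T0 hf.
(* The ball fixes [N], then [N] fixes [c], and [c] fixes the step [e]; none depends on the point
   already reached. *)
have [N N1 hN] := picard_ball_hoelder.
have N0 : 0 <= N by exact: le_trans N1.
have [c c0 hc] := delay_map_lipschitz_ex N1 hf.
have [e e_gt0 rate] := picard_rate_small c0.
pose P a := exists2 y, picard_ball a y &
  forall t, - h <= t -> t <= a -> picard y t = y t.
apply: (@step_ind P e e_gt0 T0) => [|a b a0 ab bT bae [y By fy]].
  exists xi; last by move=> t _ t0; rewrite picard_neg.
  split=> //; apply: hoelder_on_local; apply: hoelder_on_le xi_hoelder.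
  have : 0 <= d%:R * M * X * e0 `^ (gamma - lambda) by rewrite !mulr_ge0 ?powR_ge0.
  by rewrite /radius; have := Xi0; lra.
exact: (picard_extend c0 N0 hc rate hN a0 ab bT bae By fy).
Qed.

End Ball.

(** The integral is a relation in [delay_solution] and a limit in [picard]. They agree because the
    Young sums converge for Hölder [y]. *)
Lemma delay_solution_picard b y L : 0 <= L -> 0 <= b -> b <= T ->
  hoelder_on lambda (- h) b y L ->
  delay_solution f b h x xi y <-> forall t, - h <= t -> t <= b -> picard y t = y t.
Proof.
move=> L0 b0 bT hy; split=> [[sol init] t ht tb|fix_y].
  have [t0|t0] := ltP t 0.
    rewrite picard_neg ?ltW// -init ?in_itv /= ?ht ?ltW//.
    by rewrite /segment add0r.
  have [|I hI ->] := sol t; first by rewrite in_itv /= t0 tb.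
  by rewrite /picard ltNge t0 /= (young_integralE t0 hI).
have hp := h0.
split=> [t|t]; rewrite in_itv /= => /andP[lt_ tu].
  exists (young_integral (delay_map f y) x 0 t).
    exact: delay_map_integral hy.
  rewrite -fix_y//; last by lra.
  by rewrite /picard ltNge lt_.
rewrite /segment add0r -fix_y ?picard_neg//.
exact: le_trans b0.
Qed.

End BoundedLipschitz.
End DelayEquation.

Theorem theorem3p2 (R : realType) (n d : nat) (T h gamma lambda : R)
    (x : R -> 'cV[R]_d) (xi : R -> 'cV[R]_n)
    (f : (R -> 'cV[R]_n) -> 'M[R]_(n, d)) :
  0 < T -> 0 < h -> 1 / 2 < gamma ->
  hoelder_space gamma 0 T x ->
  hoelder_space gamma (- h) 0 xi ->
  1 / 2 < lambda -> lambda < gamma ->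
  bounded_lipschitz f h lambda ->
  locally_lipschitz_delay_map f T h lambda ->
  exists y : R -> 'cV[R]_n,
    [/\ hoelder_space_from lambda h xi 0 T y,
        delay_solution f T h x xi y &
        forall y' : R -> 'cV[R]_n,
          hoelder_space_from lambda h xi 0 T y' ->
          delay_solution f T h x xi y' ->
          {in `[- h, T], y' =1 y}].
Proof.
move=> T0 h0 gamma_gt x_space xi_space lambda_gt lambda_gamma [M M0 [f_bdd f_lip]] hf.
have lambda0 : 0 < lambda by lra.
have gamma0 : 0 < gamma by lra.
have [X X0 hX] := (hoelder_spaceP 0 T x gamma0).1 x_space.
have [Y Y0 hY] := (hoelder_spaceP (- h) 0 xi gamma0).1 xi_space.
(* The initial path has exponent [gamma]; the ball is built with exponent [lambda]. *)
have hxi := hoelder_on_exponent lambda0 lambda_gamma Y0 hY.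
have Xi0 : 0 <= Y * (0 - - h) `^ (gamma - lambda) by rewrite mulr_ge0 ?powR_ge0.
have [e e0 rate] := picard_rate_small (d := d) lambda_gt lambda_gamma X0 (ltW M0).
have [y By fy] := picard_exists h0 lambda_gt lambda_gamma (ltW M0) f_bdd f_lip X0 hX
  e0 rate Xi0 hxi (ltW T0) hf.
have [N N1 hN] := picard_ball_hoelder (d := d) T h gamma xi lambda_gt (ltW M0) X0 e0 Xi0.
have hy := hN _ _ (lexx T) By; have N0 : 0 <= N by exact: le_trans N1.
have solP z L : 0 <= L -> hoelder_on lambda (- h) T z L ->
    delay_solution f T h x xi z <->
    forall t, - h <= t -> t <= T -> picard x xi f z t = z t.
  by move=> L0; exact: (delay_solution_picard xi h0 lambda_gt lambda_gamma (ltW M0)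
    f_lip X0 hX L0 (ltW T0) (lexx T)).
exists y; split.
- split.
    by rewrite sub0r; apply/hoelder_spaceP => //; exists N.
  by move=> t; rewrite sub0r in_itv /= => /andP[]; exact: By.2.
- exact/(solP y N).
move=> y' [] + _ sol'; rewrite sub0r => /(hoelder_spaceP _ _ _ lambda0)[N' N'0 hy'].
move=> t; rewrite in_itv /= => /andP[ht tT].
(* A competing solution need not lie in the ball. [N + N'] bounds both solutions, and condition (ii)
   at this level gives a new constant and a new step length. *)
have NN' : N <= N + N' by rewrite lerDl.
have N'N : N' <= N + N' by rewrite lerDr.
have [c c0 hc] := delay_map_lipschitz_ex lambda_gt (le_trans N1 NN') hf.
have [e' e'0 rate'] := picard_rate_small (d := d) lambda_gt lambda_gamma X0 c0.
exact: (picard_unique h0 lambda_gt lambda_gamma (ltW M0) f_lip X0 hX c0 e'0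
  (le_trans N0 NN') (ltW T0) hc rate' (hoelder_on_le N'N hy') (hoelder_on_le NN' hy)
  ((solP _ _ N'0 hy').1 sol') fy ht tT).
Qed.
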